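(* Let $k$ and $n$ be non-negative integers. Let $p_1,p_2,\ldots,p_{k+1}$ be odd primes such that $p_i\not\equiv 1 \pmod 4$ for each $1\leq i\leq k+1$. Then for any integer $j\not\equiv 0 \pmod{p_{k+1}}$, $$\bar{B}_{5,2}\left(4p_1^2p_2^2\cdots p_k^2p_{k+1}^2 n + (4j+p_{k+1})p_1^2p_2^2\cdots p_k^2 p_{k+1}\right)\equiv 0 \pmod 4.$$
   Context: An overpartition of a positive integer $n$ is a partition of $n$ in which the first occurrence of each distinct part may be overlined. For coprime integers $\ell_1,\ell_2>1$, $\bar{B}_{\ell_1,\ell_2}(n)$ denotes the number of overpartitions of $n$ in which no part is divisible by $\ell_1$ or by $\ell_2$, with $\bar{B}_{\ell_1,\ell_2}(0)=1$. *)

(* Defs.v *)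
From mathcomp Require Import all_boot all_order all_algebra.
Set Implicit Arguments.
Unset Strict Implicit.
Unset Printing Implicit Defensive.

(* A part is a pair (size, overlined?).  Parts are listed in weakly decreasing
   order, so equal parts are adjacent and the i-th entry is the first
   occurrence of its size exactly when [index] returns i. *)
Definition overpartition (n : nat) (s : seq (nat * bool)) : bool :=
  [&& sorted geq (unzip1 s),
      all (leq 1) (unzip1 s),
      sumn (unzip1 s) == n &
      [forall i : 'I_(size s),
         (nth (0, false) s i).2 ==>
         (index (nth (0, false) s i).1 (unzip1 s) == i)]].

Definition regular_parts (l1 l2 : nat) (s : seq (nat * bool)) : bool :=
  all (fun a => ~~ (l1 %| a) && ~~ (l2 %| a)) (unzip1 s).

Lemma overpartition_bounds (n : nat) (s : seq (nat * bool)) :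
  overpartition n s -> size s <= n /\ all (fun a => a <= n) (unzip1 s).
Proof.
case/and4P=> _ pos /eqP <- _; rewrite -(size_map fst s) -/(unzip1 s).
elim: (unzip1 s) pos => //= a t IH /andP[a_gt0 /IH[le_t le_a]]; split.
  by rewrite -add1n leq_add.
rewrite leq_addr; apply: sub_all le_a => b le_b.
exact: leq_trans le_b (leq_addl _ _).
Qed.

(* By overpartition_bounds, summing over the number of parts r <= n and over
   r-tuples of parts of size <= n loses nothing. *)
Definition num_overpartitions (l1 l2 n : nat) : nat :=
  \sum_(r < n.+1)
    #|[set t : r.-tuple ('I_n.+1 * bool) |
        let s := [seq (nat_of_ord x.1, x.2) | x <- t] in
        overpartition n s && regular_parts l1 l2 s]|.

(* Indexed by int, with the usual convention that a negative integer has no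
   overpartitions. *)
Definition Bbar (l1 l2 : nat) (m : int) : nat :=
  match m with
  | Posz n => num_overpartitions l1 l2 n
  | Negz _ => 0
  end.

(* Main.v *)
(* A partition with d distinct part sizes underlies 2^d overpartitions, so
   modulo 4 only the partitions n = a + ... + a with a single part size count,
   each contributing 2: the number of overpartitions of n is congruent to twice
   the number of allowed divisors a of n. If membership in the set of allowed
   parts does not depend on the p-part, that number is a multiple of
   v_p(n) + 1, hence even when v_p(n) is odd. In the theorem v_p(n) is odd for
   p = p_{k+1}, which is prime to 10. *)

Require Import Defs.
From mathcomp Require Import all_boot all_order all_algebra.
From mathcomp Require Import ring.
Set Implicit Arguments.
Unset Strict Implicit.
Unset Printing Implicit Defensive.
Import GRing.Theory.

Lemma perm_divisorsM (m n : nat) : 0 < m -> 0 < n -> coprime m n ->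
  perm_eq (divisors (m * n)) [seq d * e | d <- divisors m, e <- divisors n].
Proof.
move=> m_gt0 n_gt0 mn; have mn_gt0 : 0 < m * n by rewrite muln_gt0 m_gt0.
apply: uniq_perm; first exact: divisors_uniq.
  apply: allpairs_uniq; rewrite ?divisors_uniq // => de de'.
  case/allpairsP=> -[d e] /= [dm en ->] /allpairsP[[d' e'] /= [dm' en' ->]] /=.
  move: dm en dm' en'; rewrite -!dvdn_divisors // => dm en dm' en' eq_de.
  have gcd_m a b : a %| m -> b %| n -> gcdn m (a * b) = a.
    by move=> am bn; rewrite Gauss_gcdl ?(coprime_dvdr bn) //; apply/gcdn_idPr.
  have eq_d : d = d' by rewrite -(gcd_m d e) // eq_de gcd_m.
  have d_gt0 : 0 < d by apply: dvdn_gt0 dm.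
  by move/eqP: eq_de; rewrite -eq_d eqn_pmul2l // => /eqP ->.
move=> x; rewrite -dvdn_divisors //; apply/idP/allpairsP => [x_mn | [[d e] /=]].
  exists (gcdn x m, x %/ gcdn x m); rewrite /= -!dvdn_divisors //.
  split; [exact: dvdn_gcdr | | by rewrite mulnC divnK ?dvdn_gcdl].
  rewrite dvdn_divLR ?dvdn_gcdl ?gcdn_gt0 ?m_gt0 ?orbT //.
  by rewrite muln_gcdr dvdn_gcd dvdn_mull //= mulnC.
by rewrite -!dvdn_divisors // => -[dm en ->]; apply: dvdn_mul.
Qed.

Lemma size_divisors_pfactor (p k : nat) :
  prime p -> size (divisors (p ^ k)) = k.+1.
Proof.
move=> p_pr; have p_gt1 := prime_gt1 p_pr.
rewrite -[RHS](size_iota 0) -[RHS](size_map (expn p)); apply: perm_size.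
apply: uniq_perm; rewrite ?divisors_uniq //.
  by rewrite map_inj_uniq ?iota_uniq //; apply: expnI.
move=> d; rewrite -dvdn_divisors ?expn_gt0 ?prime_gt0 //.
apply/(dvdn_pfactor _ _ p_pr)/mapP => -[i].
  by move=> le_ik ->; exists i; rewrite // mem_iota.
by rewrite mem_iota => /= le_ik ->; exists i.
Qed.

Lemma count_divisors_pfactor (P : pred nat) (p n : nat) :
  prime p -> 0 < n -> (forall d, P (p * d) = P d) ->
  count P (divisors n) = (logn p n).+1 * count P (divisors n`_p^').
Proof.
move=> p_pr n_gt0 P_p.
have P_pX i d : P (p ^ i * d) = P d.
  by elim: i => [|i IHi]; rewrite ?mul1n // expnS -mulnA P_p.
have /permP-> : perm_eq (divisors n)
    [seq d * e | d <- divisors n`_p, e <- divisors n`_p^'].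
  by rewrite -{1}(partnC p n_gt0) perm_divisorsM ?part_gt0 ?coprime_partC.
rewrite -(size_divisors_pfactor (logn p n) p_pr) -p_part.
have : {in divisors n`_p, forall d, d %| p ^ logn p n}.
  by move=> d; rewrite -dvdn_divisors ?part_gt0 ?p_part.
elim: (divisors _) => //= d s IHs p_s; rewrite count_cat mulSn; congr (_ + _).
  have /(dvdn_pfactor _ _ p_pr)[i _ ->] := p_s d (mem_head d s).
  by rewrite count_map; apply: eq_count => e; apply: P_pX.
by apply: IHs => e es; apply: p_s; rewrite inE es orbT.
Qed.

Lemma perm_divn_divisors (n : nat) : 0 < n ->
  perm_eq [seq n %/ d | d <- divisors n] (divisors n).
Proof.
move=> n_gt0; have divK d : d %| n -> n %/ (n %/ d) = d.
  by move=> dn; rewrite divnA // mulKn.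
apply: uniq_perm; rewrite ?divisors_uniq //.
  rewrite map_inj_in_uniq ?divisors_uniq // => d e.
  by rewrite -!dvdn_divisors // => dn en /(congr1 (divn n)); rewrite !divK.
move=> e; apply/mapP/idP => [[d]|]; rewrite -!dvdn_divisors //.
  by move=> dn ->; apply: dvdn_div.
by move=> en; exists (n %/ e); rewrite ?divK // -dvdn_divisors ?dvdn_div.
Qed.

Lemma sum_codivisors (P : pred nat) (n : nat) : 0 < n ->
  \sum_(r < n.+1) ((r %| n) && P (n %/ r)) = count P (divisors n).
Proof.
move=> n_gt0; rewrite -(permP (perm_divn_divisors n_gt0)) count_map.
have /permP-> : perm_eq (divisors n) [seq r <- iota 0 n.+1 | r %| n].
  apply: uniq_perm; rewrite ?divisors_uniq ?filter_uniq ?iota_uniq // => d.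
  rewrite mem_filter mem_iota -dvdn_divisors //=.
  by case dn: (d %| n); rewrite //= ltnS dvdn_leq.
rewrite count_filter -sumn_count sumnE big_map.
rewrite -(big_mkord predT (fun r => (r %| n) && P (n %/ r) : nat)) /index_iota.
by rewrite subn0; apply: eq_bigr => r _ /=; rewrite andbC.
Qed.

Lemma undup_nseq (T : eqType) (n : nat) (x : T) :
  undup (nseq n.+1 x) = [:: x].
Proof. by elim: n => //= n ->; rewrite inE eqxx. Qed.

Lemma size_undup_eq1 (T : eqType) (s : seq T) :
  (size (undup s) == 1) = (0 < size s) && constant s.
Proof.
case: s => [//|x s]; apply/idP/idP => [|/(constantP x)[y ->]]; last first.
  by rewrite undup_nseq.
case undup_s: (undup _) => [//|y [|//]] _; apply: (@all_pred1_constant _ y).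
by apply/allP => z; rewrite -mem_undup undup_s inE.
Qed.

Definition first_occurrences (r : nat) (T : eqType) (u : r.-tuple T) :
    {set 'I_r} :=
  [set i | index (tnth u i) u == i].

Lemma card_first_occurrences (r : nat) (T : eqType) (u : r.-tuple T) :
  #|first_occurrences u| = size (undup u).
Proof.
rewrite cardE -(size_map (tnth u)); apply: perm_size.
apply: uniq_perm; rewrite ?undup_uniq //.
  rewrite map_inj_in_uniq ?enum_uniq // => i j; rewrite !mem_enum !inE.
  move=> /eqP i_first /eqP j_first eq_ij; apply: val_inj.
  by rewrite /= -i_first eq_ij.
move=> x; rewrite mem_undup; apply/mapP/idP => [[i _ ->]|xu].
  exact: mem_tnth.
have lt_x : index x u < r by rewrite -{2}(size_tuple u) index_mem.
by exists (Ordinal lt_x); rewrite ?mem_enum ?inE (tnth_nth x) /= nth_index.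
Qed.

Definition overlined (r : nat) (T : Type) (t : r.-tuple (T * bool)) :
    {set 'I_r} :=
  [set i | (tnth t i).2].

Lemma card_overlinings (r : nat) (T : finType) (u : r.-tuple T) :
  #|[set t : r.-tuple (T * bool) | (map_tuple fst t == u) &&
      (overlined t \subset first_occurrences u)]| = 2 ^ size (undup u).
Proof.
rewrite -card_first_occurrences -card_powerset.
pose overline (A : {set 'I_r}) := [tuple (tnth u i, i \in A) | i < r].
have overlineK : cancel overline (@overlined r T).
  by move=> A; apply/setP => i; rewrite inE tnth_mktuple.
have fst_overline A : map_tuple fst (overline A) = u.
  by apply: eq_from_tnth => i; rewrite tnth_map tnth_mktuple.
rewrite -(card_imset _ (can_inj overlineK)); apply: eq_card => t.
rewrite inE; apply/andP/imsetP => [[/eqP fst_t sub_t] | [A]].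
  exists (overlined t); rewrite ?powersetE //.
  apply: eq_from_tnth => i; rewrite tnth_mktuple inE -fst_t tnth_map.
  exact: surjective_pairing.
by rewrite powersetE => sub_A ->; rewrite fst_overline overlineK eqxx.
Qed.

Definition integer_partition (P : pred nat) (n : nat) (s : seq nat) : bool :=
  [&& sorted geq s, all (leq 1) s, sumn s == n & all P s].

Definition regular (l1 l2 a : nat) : bool := ~~ (l1 %| a) && ~~ (l2 %| a).

Lemma overpartition_tupleE (l1 l2 n m r : nat) (t : r.-tuple ('I_m * bool)) :
  let s := [seq (nat_of_ord x.1, x.2) | x <- t] in
  overpartition n s && regular_parts l1 l2 s =
  integer_partition (regular l1 l2) n (map val (map_tuple fst t)) &&
    (overlined t \subset first_occurrences (map_tuple fst t)).
Proof.
move=> s; rewrite /overpartition /regular_parts /integer_partition.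
have -> : unzip1 s = map val (map_tuple fst t) by rewrite /unzip1 -!map_comp.
rewrite -!andbA; do 3!congr (_ && _); rewrite andbC; congr (_ && _).
have size_s : size s = r by rewrite size_map size_tuple.
have overlined_firstE (i : 'I_r) :
    ((nth (0, false) s i).2 ==>
       (index (nth (0, false) s i).1 (map val (map_tuple fst t)) == i)) =
    ((i \in overlined t) ==> (i \in first_occurrences (map_tuple fst t))).
  rewrite (nth_map (tnth t i)) ?size_tuple // -tnth_nth !inE tnth_map.
  by rewrite (index_map val_inj).
apply/forallP/subsetP => over i.
  have := over (cast_ord (esym size_s) i).
  by rewrite [X in is_true X]overlined_firstE => /implyP.
apply: etrans (overlined_firstE (cast_ord size_s i)) _.
exact/implyP/over.
Qed.

Lemma num_overpartitionsE (l1 l2 n : nat) :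
  num_overpartitions l1 l2 n =
  \sum_(r < n.+1) \sum_(u : r.-tuple 'I_n.+1 |
      integer_partition (regular l1 l2) n (map val u)) 2 ^ size (undup u).
Proof.
apply: eq_bigr => r _; rewrite -sum1_card.
rewrite (partition_big (fun t : r.-tuple _ => map_tuple fst t)
  (fun u : r.-tuple _ => integer_partition (regular l1 l2) n (map val u))).
  apply: eq_bigr => u u_part; rewrite -card_overlinings -sum1_card.
  apply: eq_bigl => t; rewrite inE /= overpartition_tupleE [in RHS]inE.
  by case: eqP => [->|]; rewrite ?u_part ?andbT ?andbF.
by move=> t; rewrite inE /= overpartition_tupleE => /andP[].
Qed.

Lemma integer_partition_nseq (P : pred nat) (n r a : nat) : 0 < n ->
  integer_partition P n (nseq r a) = (a * r == n) && P a.
Proof.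
move=> n_gt0; rewrite /integer_partition sumn_nseq !all_nseq.
case: (a * r =P n) => [n_ar|_]; last by rewrite /= !andbF.
move: n_gt0; rewrite -n_ar muln_gt0 => /andP[-> r_gt0].
rewrite eqn0Ngt r_gt0 /=; case: r {n_ar r_gt0} => //= r.
suff -> : path geq a (nseq r a) by [].
by elim: r => //= r ->; rewrite leqnn.
Qed.

Lemma card_constant_partitions (P : pred nat) (n r : nat) : 0 < n ->
  #|[set u : r.-tuple 'I_n.+1 | integer_partition P n (map val u)
      & constant u]| = (r %| n) && P (n %/ r).
Proof.
move=> n_gt0; case: (posnP r) => [-> | r_gt0].
  rewrite dvd0n eqn0Ngt n_gt0; apply: eq_card0 => u.
  by rewrite [u]tuple0 inE /integer_partition /= eq_sym eqn0Ngt n_gt0.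
set c : r.-tuple 'I_n.+1 := [tuple of nseq r (inord (n %/ r))].
have map_c : map val c = nseq r (n %/ r).
  by rewrite map_nseq /= inordK // ltnS leq_div.
have c_part : integer_partition P n (map val c) = (r %| n) && P (n %/ r).
  by rewrite map_c integer_partition_nseq // dvdn_eq.
have constant_eq (u : r.-tuple 'I_n.+1) :
    integer_partition P n (map val u) -> constant u -> u = c.
  move=> + /(constantP ord0)[a]; rewrite size_tuple => + u_a.
  rewrite u_a map_nseq integer_partition_nseq // => /andP[/eqP n_a _].
  by apply: val_inj; rewrite /= u_a -[X in X %/ _]n_a mulnK // inord_val.
rewrite -c_part; case c_partE: (integer_partition P n (map val c)).
  apply: etrans (cards1 c); apply: eq_card => u; rewrite !inE.
  apply/andP/eqP => [[] | ->]; first exact: constant_eq.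
  by rewrite c_partE constant_nseq.
apply: eq_card0 => u; rewrite inE; apply: contraFF c_partE => /andP[u_part].
by move/(constant_eq u u_part) <-.
Qed.

Lemma exp2_mod4 (c : nat) : 0 < c -> 2 ^ c = 2 * (c == 1) %[mod 4].
Proof. by case: c => [//|[//|c]] _; rewrite !expnS mulnA modnMr. Qed.

Lemma num_overpartitions_mod4 (l1 l2 n : nat) : 0 < n ->
  num_overpartitions l1 l2 n =
  2 * count (regular l1 l2) (divisors n) %[mod 4].
Proof.
move=> n_gt0; rewrite num_overpartitionsE -sum_codivisors // big_distrr /=.
rewrite -modn_summ -[RHS]modn_summ; congr (_ %% 4); apply: eq_bigr => r _.
rewrite -card_constant_partitions // -sum1dep_card big_distrr /=.
rewrite [in RHS]big_mkcondr /=.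
rewrite -modn_summ -[RHS]modn_summ; congr (_ %% 4); apply: eq_bigr => u u_part.
have u_gt0 : 0 < size u.
  case: (tval u) u_part => // /and4P[_ _ /eqP sum_u _].
  by rewrite -sum_u in n_gt0.
rewrite exp2_mod4 ?size_undup_eq1 ?u_gt0 /=; first by case: (constant u).
by rewrite lt0n; apply: contraTneq u_gt0 => /size0nil/undup_nil ->.
Qed.

Lemma regular_mull (l1 l2 p a : nat) : coprime l1 p -> coprime l2 p ->
  regular l1 l2 (p * a) = regular l1 l2 a.
Proof. by move=> l1p l2p; rewrite /regular !Gauss_dvdr. Qed.

Lemma dvd4_num_overpartitions (l1 l2 p n : nat) :
  coprime l1 p -> coprime l2 p -> odd (logn p n) ->
  4 %| num_overpartitions l1 l2 n.
Proof.
move=> l1p l2p odd_p.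
have : p \in primes n by rewrite -logn_gt0 odd_gt0.
rewrite mem_primes => /and3P[p_pr n_gt0 _].
rewrite /dvdn num_overpartitions_mod4 // -/(dvdn 4 _).
rewrite (count_divisors_pfactor p_pr) => [||a]; rewrite ?regular_mull //.
by rewrite mulnA dvdn_mulr // (@dvdn_pmul2l 2 2) // dvdn2 /= negbK.
Qed.

Lemma dvd4_Bbar (l1 l2 p : nat) (m : int) :
  coprime l1 p -> coprime l2 p -> odd (logn p `|m|) -> 4 %| Bbar l1 l2 m.
Proof. by case: m => // n; apply: dvd4_num_overpartitions. Qed.

Lemma odd_logn_sqrM (p m w : nat) :
  prime p -> 0 < m -> ~~ (p %| w) -> odd (logn p (m ^ 2 * p * w)).
Proof.
move=> p_pr m_gt0 p_w; have w_gt0 : 0 < w by case: w p_w; rewrite ?dvdn0.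
rewrite -mulnn !lognM ?muln_gt0 ?m_gt0 ?(prime_gt0 p_pr) // addnn.
rewrite (logn_prime p p_pr) eqxx [logn p w]logn_coprime ?prime_coprime //.
by rewrite addn0 addn1 /= odd_double.
Qed.

Local Open Scope ring_scope.

Lemma dvd4_Bbar_sqrM (l1 l2 p : nat) (m w : int) :
  prime p -> coprime l1 p -> coprime l2 p -> m != 0 -> ~~ (p %| w)%Z ->
  (4 %| Bbar l1 l2 (m ^+ 2 * p%:Z * w))%N.
Proof.
move=> p_pr l1p l2p m_neq0 p_w; apply: (dvd4_Bbar l1p l2p).
by rewrite 2!abszM abszX odd_logn_sqrM ?absz_gt0.
Qed.

Theorem theorem5p2 (k n : nat) (p : nat -> nat)
  (hp : forall i : nat, (1 <= i <= k.+1)%N ->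
     [/\ prime (p i), odd (p i) & p i <> 1 %[mod 4]])
  (j : int) (hj : (j <> 0 %[mod (p k.+1)%:Z])%Z) :
  (Bbar 5 2
     (4 * (\prod_(1 <= i < k.+1) (p i)%:Z ^+ 2) * (p k.+1)%:Z ^+ 2 * n%:Z
      + (4 * j + (p k.+1)%:Z) * (\prod_(1 <= i < k.+1) (p i)%:Z ^+ 2)
        * (p k.+1)%:Z)
   = 0 %[mod 4])%N.
Proof.
have [] := hp k.+1; first by rewrite leqnn.
set q := p k.+1 => q_pr q_odd q_mod4.
rewrite prodrXl; set Q := \prod_(1 <= i < k.+1) _.
pose w := q%:Z * (4 * n%:Z + 1) + 4 * j.
rewrite (_ : _ + _ = Q ^+ 2 * q%:Z * w); last by rewrite /w; ring.
apply/eqP/dvd4_Bbar_sqrM; rewrite ?coprime2n //.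
- rewrite prime_coprime // dvdn_prime2 //.
  by apply: contra_notN q_mod4 => /eqP <-.
- rewrite prodf_seq_neq0; apply/allP => i; rewrite mem_index_iota.
  move=> /andP[i_gt0 i_le]; have [] := hp i; first by rewrite i_gt0 ltnW.
  by move/prime_gt0; rewrite lt0n.
- rewrite rpredDl ?(dvdz_mulr _ (dvdzz q)) // Gauss_dvdzr.
    by apply/negP => /dvdz_mod0P j0; apply: hj; rewrite mod0z.
  by rewrite coprimezE (@coprimeXr 2 q 2) // coprimen2.
Qed.
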